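(* Let $(X,d)$ be a metric space (not assumed proper) with basepoint $x_0$, let $G$ be a group acting on $X$ by isometries, let $(\Omega,\mu)$ be a standard Borel probability space, and let $L:\Omega\to\Omega$ be an ergodic measure-preserving transformation. Let $g_1:\Omega\to G$ be measurable with $\int_\Omega d(g_1(\omega)x_0,x_0)\,d\mu(\omega)<\infty$, and set $Z_n(\omega)=g_1(\omega)g_1(L\omega)\cdots g_1(L^{n-1}\omega)$. Assume that the cocycle is ballistic, i.e. $$A:=\inf_{n>0}\frac1n\int_\Omega d(Z_n(\omega)x_0,x_0)\,d\mu(\omega)>0 .$$ Then for $\mu$-almost every $\omega$ and every $\varepsilon>0$ there is an integer $N=N(\omega,\varepsilon)$ such that for every integer $M>N$, $$\bigcap_{k=N}^{M}U_\varepsilon\big(Z_k(\omega)x_0\big)\neq\varnothing .$$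
   Context: For $y\in X$ and $\varepsilon>0$, the $\varepsilon$-shadow of $y$ (seen from the basepoint $x_0$) is $$U_\varepsilon(y)=\{z\in X:\ d(x_0,y)+d(y,z)\le d(x_0,z)+\varepsilon\, d(x_0,y)\}.$$ Measurability of $g_1$ is understood to ensure that $\omega\mapsto d(Z_n(\omega)x_0,x_0)$ is measurable for each $n\ge1$. The case of a random walk on a group is the one where the $g_1(L^i\omega)$, $i\ge 0$, are independent and identically distributed; an example of $X$ is $G$ itself with a left-invariant metric such as a word metric. *)

(* Defs.v *)
From HB Require Import structures.
From mathcomp Require Import all_boot all_order all_algebra.
From mathcomp Require Import all_classical all_reals all_analysis.
Set Implicit Arguments.
Unset Strict Implicit.
Unset Printing Implicit Defensive.
Import Order.TTheory GRing.Theory Num.Theory.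
Local Open Scope classical_set_scope.
Local Open Scope ring_scope.

(* Separable, with every Cauchy (proper) filter convergent. *)
Definition polish_metric (R : realType) (P : metricType R) : Prop :=
  (forall F : set_system P, ProperFilter F -> cauchy F ->
     exists l : P, F --> l) /\
  (exists D : set P, countable D /\ dense D).

(* The sigma-algebra of T is carried by a bijection onto the Borel
   sigma-algebra of a Polish space. *)
Definition standard_borel (R : realType) (d : measure_display)
    (T : measurableType d) : Prop :=
  exists (P : metricType R) (f : T -> P),
    [/\ polish_metric P, bijective f &
        forall A : set T, measurable A <-> <<s @open P >> (f @` A)].

Definition measure_preserving (R : realType) (d : measure_display)
    (T : measurableType d) (mu : probability T R) (L : T -> T) : Prop :=
  measurable_fun setT L /\
  forall A : set T, measurable A -> mu (L @^-1` A) = mu A.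

Definition ergodic (R : realType) (d : measure_display)
    (T : measurableType d) (mu : probability T R) (L : T -> T) : Prop :=
  forall A : set T, measurable A -> L @^-1` A = A ->
    mu A = 0%E \/ mu A = 1%E.

Definition isometric_action (R : realType) (G : groupType) (X : metricType R)
    (act : G -> X -> X) : Prop :=
  [/\ forall x, act 1%g x = x,
      forall g h x, act (g * h)%g x = act g (act h x) &
      forall g x y, mdist (act g x) (act g y) = mdist x y].

(* The product is taken in increasing order of i, and is 1 for n = 0. *)
Definition cocycle (G : groupType) (T : Type) (L : T -> T) (g1 : T -> G)
    (n : nat) (w : T) : G :=
  (\prod_(i < n) g1 (iter i L w))%g.

Definition shadow (R : realType) (X : metricType R) (x0 : X) (eps : R)
    (y : X) : set X :=
  [set z | mdist x0 y + mdist y z <= mdist x0 z + eps * mdist x0 y].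

(* Valued in \bar R, the integrals being those of nonnegative functions. *)
Definition drift (R : realType) (d : measure_display) (T : measurableType d)
    (mu : probability T R) (L : T -> T) (G : groupType) (X : metricType R)
    (act : G -> X -> X) (x0 : X) (g1 : T -> G) : \bar R :=
  ereal_inf [set ((n%:R^-1)%:E *
      \int[mu]_w (mdist (act (cocycle L g1 n w) x0) x0)%:E)%E
    | n in [set n : nat | (0 < n)%N]].

(* Main.v *)
(* Write a n w = d(Z_n(w) x0, x0) and A for the drift; d(Z_n x0, Z_(n+k) x0) is
   a k (L^n w). The common point of the shadows is z = Z_n x0 for a suitable
   n >= M, so it suffices to have, almost surely and for all delta > 0,
   - a k w <= A (1 + delta) k + O(1) for all k, and
   - for infinitely many n, for all k <= n,
     a n w - a (n - k) (L^k w) >= A (1 - delta) k - O(1)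
   (Karlsson-Margulis). Thanks to the O(1) and to the triangle inequality both
   properties define exactly L-invariant sets, hence hold almost surely or
   almost never. If one of them failed almost surely, then almost every orbit
   could be cut into pieces along which a subadditive process grows at too small
   a rate, the remaining times having a negligible contribution to its integral;
   this contradicts the lower bound on the growth of that integral. *)
Require Import Defs.
From HB Require Import structures.
From mathcomp Require Import all_boot all_order all_algebra.
From mathcomp Require Import all_classical all_reals all_analysis.
From mathcomp Require Import measurable_realfun ring lra.
Set Implicit Arguments.
Unset Strict Implicit.
Unset Printing Implicit Defensive.
Import Order.TTheory GRing.Theory Num.Theory.
Import numFieldNormedType.Exports.
Local Open Scope classical_set_scope.
Local Open Scope ring_scope.

(** * Elementary bounds, and measurability of sets defined by countable quantifiers *)

Lemma natr_bound (R : realType) (x : R) : exists K : nat, x <= K%:R.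
Proof. by exists (Num.truncn x).+1; exact/ltW/truncnS_gt. Qed.

Lemma le_of_nat_multiples (R : realType) (x y C : R) :
  (forall n, n%:R * x <= n%:R * y + C) -> x <= y.
Proof.
move=> xy; rewrite leNgt; apply/negP; rewrite -subr_gt0 => yx.
have := truncnS_gt (C / (x - y)); rewrite ltr_pdivrMr//.
by have := xy (Num.truncn (C / (x - y))).+1; set n := _%:R; nra.
Qed.

(** At most [N] indices [p < n] satisfy [n <= p + N]; this bounds the cost of the final times in
    [jump_cover]. *)
Lemma sum_last_le (R : realType) n N (x : R) : 0 <= x ->
  \sum_(0 <= p < n) (if (n <= p + N)%N then x else 0) <= N%:R * x.
Proof.
move=> x0; rewrite (big_cat_nat (leq0n (n - N)%N) (leq_subr N n))/= big_nat big1.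
  rewrite add0r; apply: (@le_trans _ _ (\sum_(n - N <= p < n) x)).
    by apply: ler_sum => p _; case: ifP.
  rewrite sumr_const_nat -[X in X <= _]mulr_natl ler_wpM2r// ler_nat.
  by rewrite leq_subLR addnC -leq_subLR.
by move=> p pn; case: ifP => // /(leq_trans _); rewrite ltn_subRL in pn;
  move=> /(_ _ pn); rewrite addnC ltnn.
Qed.

Lemma measurable_existsn (d : measure_display) (T : measurableType d)
    (P : nat -> T -> Prop) :
  (forall k, measurable [set w | P k w]) ->
  measurable [set w | exists k, P k w].
Proof.
move=> mP; rewrite [X in measurable X](_ : _ = \bigcup_k [set w | P k w]).
  exact: bigcup_measurable.
by apply/seteqP; split=> w [k]; exists k.
Qed.

Lemma measurable_foralln (d : measure_display) (T : measurableType d)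
    (P : nat -> T -> Prop) :
  (forall k, measurable [set w | P k w]) ->
  measurable [set w | forall k, P k w].
Proof.
move=> mP; rewrite [X in measurable X](_ : _ = \bigcap_k [set w | P k w]).
  exact: bigcap_measurableType.
by apply/seteqP; split=> w; [move=> Pw k _|move=> Pw k]; exact: Pw.
Qed.

Lemma measurable_set_imply (d : measure_display) (T : measurableType d)
    (Q : Prop) (P : T -> Prop) :
  measurable [set w | P w] -> measurable [set w | Q -> P w].
Proof.
move=> mP; have [q|nq] := pselect Q.
  rewrite [X in measurable X](_ : _ = [set w | P w])//.
  by apply/seteqP; split=> w /=; [exact|move=> ? _].
rewrite [X in measurable X](_ : _ = setT)//.
by apply/seteqP; split=> w //= _ /nq.
Qed.

Lemma measurable_set_and (d : measure_display) (T : measurableType d)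
    (Q : Prop) (P : T -> Prop) :
  measurable [set w | P w] -> measurable [set w | Q /\ P w].
Proof.
move=> mP; have [q|nq] := pselect Q.
  rewrite [X in measurable X](_ : _ = [set w | P w])//.
  by apply/seteqP; split=> w /=; [case|].
rewrite [X in measurable X](_ : _ = set0)//.
by apply/seteqP; split=> w //= [/nq].
Qed.

Lemma measurable_set_le (d : measure_display) (T : measurableType d)
    (R : realType) (f g : T -> R) :
  measurable_fun setT f -> measurable_fun setT g ->
  measurable [set w | f w <= g w].
Proof.
by move=> mf mg; rewrite -[X in measurable X]setTI; exact: measurable_fun_le.
Qed.

Lemma measurable_set_lt (d : measure_display) (T : measurableType d)
    (R : realType) (f g : T -> R) :
  measurable_fun setT f -> measurable_fun setT g ->
  measurable [set w | f w < g w].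
Proof.
move=> mf mg; rewrite [X in measurable X](_ : _ = ~` [set w | g w <= f w]).
  exact/measurableC/measurable_set_le.
by apply/seteqP; split=> w /=; rewrite ltNge => /negP.
Qed.

(** * Integration along a measure-preserving map *)

Section measure_preserving.
Context (R : realType) (d : measure_display) (T : measurableType d).
Context (mu : probability T R).

Local Notation int f := (mu.-integrable setT (EFin \o f)).
Local Notation E f := (Rintegral mu setT f).

Lemma integrable_measurable (f : T -> R) : int f -> measurable_fun setT f.
Proof. by move=> /(measurable_int mu)/measurable_EFinP. Qed.

Lemma integrable_dominated (f g : T -> R) :
  measurable_fun setT f -> (forall w, `|f w| <= g w) -> int g -> int f.
Proof.
move=> mf fg ig; apply: le_integrable ig => //; first exact/measurable_EFinP.
by move=> w _ /=; rewrite lee_fin (le_trans (fg w))// ler_norm.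
Qed.

Lemma integrable_const (c : R) : int (fun=> c).
Proof. exact: finite_measure_integrable_cst. Qed.

Lemma Rintegral_const (c : R) : E (fun=> c) = c.
Proof.
rewrite Rintegral_cst//.
rewrite -[RHS]mulr1; congr (_ * _).
exact: (congr1 fine (probability_setT mu)).
Qed.

Lemma integrable_addR (f g : T -> R) :
  int f -> int g -> int (fun w => f w + g w).
Proof. by move=> fi gi; exact: (integrableD measurableT fi gi). Qed.

Lemma integrable_subR (f g : T -> R) :
  int f -> int g -> int (fun w => f w - g w).
Proof. by move=> fi gi; exact: (integrableB measurableT fi gi). Qed.

Lemma integrable_sumR I (s : seq I) (f : I -> T -> R) :
  (forall i, int (f i)) -> int (fun w => \sum_(i <- s) f i w).
Proof.
move=> fi; rewrite (_ : EFin \o _ = fun w => \sum_(i <- s) (f i w)%:E)%E.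
  by apply: integrable_sum => // i _; exact: fi.
by apply/funext => w /=; rewrite sumEFin.
Qed.

Lemma Rintegral_sum I (s : seq I) (f : I -> T -> R) :
  (forall i, int (f i)) ->
  E (fun w => \sum_(i <- s) f i w) = \sum_(i <- s) E (f i).
Proof.
move=> fi; elim: s => [|i s IH].
  by rewrite big_nil -[RHS]Rintegral_const; apply: eq_Rintegral => w _;
     rewrite big_nil.
rewrite big_cons -IH -RintegralD//; last exact: integrable_sumR.
by apply: eq_Rintegral => w _; rewrite big_cons.
Qed.

Context (L : T -> T) (L_pres : measure_preserving mu L).

Lemma measure_preserving_iter n : measure_preserving mu (iter n L).
Proof.
elim: n => [|n [mn prn]]; first by split => //; exact: measurable_id.
have [mL prL] := L_pres; split=> [|A mA]; first exact: measurableT_comp.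
have mLA : measurable (L @^-1` A) by rewrite -[X in measurable X]setTI; exact: mL.
by rewrite -(prL A mA) -(prn _ mLA).
Qed.

Lemma integral_comp_pres (f : T -> R) : measurable_fun setT f ->
  (forall w, 0 <= f w) ->
  (\int[mu]_w (f (L w))%:E = \int[mu]_w (f w)%:E)%E.
Proof.
have [mL prL] := L_pres => mf f0.
have -> : (\int[mu]_w (f w)%:E = \int[pushforward mu L]_w (f w)%:E)%E.
  by apply: eq_measure_integral => A mA _; exact: (esym (prL A mA)).
rewrite ge0_integral_pushforward//; first exact/measurable_EFinP.
by move=> w _; rewrite lee_fin.
Qed.

Lemma integrable_comp_pres (f : T -> R) : int f -> int (f \o L).
Proof.
have [mL _] := L_pres => fi; have mf := integrable_measurable fi.
apply/integrableP; split.
  by apply/measurable_EFinP; exact: measurableT_comp.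
rewrite /= (integral_comp_pres (f := fun w => `|f w|))//.
- by case/integrableP : fi.
- exact: measurableT_comp.
Qed.

Lemma Rintegral_comp_pres (f : T -> R) : int f -> E (f \o L) = E f.
Proof.
have [mL prL] := L_pres => fi; have mf := integrable_measurable fi.
rewrite /Rintegral; congr fine.
have -> : (\int[mu]_w (f w)%:E = \int[pushforward mu L]_w (f w)%:E)%E.
  by apply: eq_measure_integral => A mA _; exact: (esym (prL A mA)).
rewrite integral_pushforward//; first exact/measurable_EFinP.
exact: integrable_comp_pres.
Qed.

End measure_preserving.

(** * Cutting orbits into jumps *)

(** The first [k] times of the orbit segment can be cut off as one piece along which [b] grows at
    rate at most [c]. *)
Definition jumps (R : realType) (T : Type) (L : T -> T) (b : nat -> T -> R)
    (c : R) (n : nat) (w : T) : Prop :=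
  exists k, (0 < k <= n)%N /\ b n w <= c * k%:R + b (n - k)%N (iter k L w).

(* Greedy decomposition of the orbit segment of length n: jump at good points,
   advance by one step (at cost g) at bad points and at the last N times. *)
Lemma jump_cover (R : realType) (T : Type) (L : T -> T) (b : nat -> T -> R)
    (g h : T -> R) (c : R) (N : nat) :
  0 <= c -> (forall w, 0 <= g w) -> (forall w, 0 <= h w) ->
  (forall w, b 0%N w <= 0) ->
  (forall n w, b n.+1 w <= g w + b n (L w)) ->
  (forall w, (forall n, (N <= n)%N -> (0 < n)%N -> jumps L b c n w) \/
     h w = g w) ->
  forall n w, b n w <= \sum_(0 <= p < n)
    (c + h (iter p L w) + (if (n <= p + N)%N then g (iter p L w) else 0)).
Proof.
move=> c0 g0 h0 b0 bS good.
pose F n w p := c + h (iter p L w) +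
  (if (n <= p + N)%N then g (iter p L w) else 0).
have F0 n w p : c <= F n w p.
  rewrite /F; have := h0 (iter p L w); have := g0 (iter p L w).
  by case: ifP => _; lra.
(* The condition [n <= p + k + N] is [n - k <= p + N]: the last [N] times are counted from the end,
   so the tail of the sum is exactly the bound for the segment left after [k] steps. *)
have shift n k w : (k <= n)%N -> \sum_(0 <= p < n) F n w p =
    \sum_(0 <= p < k) F n w p + \sum_(0 <= p < n - k) F (n - k)%N (iter k L w) p.
  move=> kn; rewrite (big_cat_nat (leq0n k) kn)//=; congr (_ + _).
  rewrite -{1}[k]add0n big_addn; apply: eq_bigr => p _.
  by rewrite /F iterD leq_subLR addnAC [(p + N + k)%N]addnC.
elim/ltn_ind => -[|n] IH w; first by rewrite big_nil.
(* A single step costs [g w], which the term at time 0 covers both at bad points and among the last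
   [N] times. *)
have step : F n.+1 w 0%N >= g w -> b n.+1 w <= \sum_(0 <= p < n.+1) F n.+1 w p.
  move=> gF; apply: le_trans (bS n w) _.
  rewrite (shift _ 1%N)// big_nat1 subn1 /= lerD//.
  exact: IH.
have [nN|Nn] := leqP n.+1 N.
  by apply: step; rewrite /F add0n nN /=; have := h0 w; lra.
have [gw|hw] := good w; last first.
  by apply: step; rewrite /F /= hw; have := g0 w; case: ifP; lra.
have [k [/andP[k0 kn] bk]] := gw n.+1 (ltnW Nn) isT.
apply: le_trans bk _; rewrite (shift _ k)// lerD//; last first.
  by apply: IH; rewrite -subSn// leq_subLR -addn1 addnC leq_add2r.
rewrite mulr_natr -[X in _ *+ X]subn0 -sumr_const_nat.
exact: ler_sum.
Qed.

Section covering.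
Context (R : realType) (d : measure_display) (T : measurableType d).
Context (mu : probability T R).
Context (L : T -> T) (L_pres : measure_preserving mu L).

Local Notation int f := (mu.-integrable setT (EFin \o f)).
Local Notation E f := (Rintegral mu setT f).

Lemma Rintegral_iter (f : T -> R) n : int f -> E (f \o iter n L) = E f.
Proof. exact/Rintegral_comp_pres/measure_preserving_iter. Qed.

Lemma integrable_iter (f : T -> R) n : int f -> int (f \o iter n L).
Proof. exact/integrable_comp_pres/measure_preserving_iter. Qed.

(** Integrating [jump_cover] bounds [n * alpha] by [n * (c + E (h N)) + N * E g]. Letting first [n]
    and then [N] go to infinity removes the last [N] times, then the bad points. *)
Lemma drift_le_jump_rate (b : nat -> T -> R) (g : T -> R) (c alpha : R) :
  0 <= c -> (forall w, 0 <= g w) -> int g -> (forall n, int (b n)) ->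
  (forall w, b 0%N w <= 0) ->
  (forall n w, b n.+1 w <= g w + b n (L w)) ->
  {ae mu, forall w, exists N, forall n, (N <= n)%N -> (0 < n)%N ->
     jumps L b c n w} ->
  (forall n, n%:R * alpha <= E (b n)) ->
  alpha <= c.
Proof.
move=> c0 g0 ig ib b0 bS aeg balpha.
pose good N := [set w | forall n, (N <= n)%N -> (0 < n)%N -> jumps L b c n w].
(* The one-step cost, charged only at points not yet good at threshold [N]. Almost every point is
   good for all large [N], so [E (h N)] tends to 0 by domination by [g]. *)
pose h N := g \_ (~` good N).
have mL n : measurable_fun setT (iter n L).
  by have [] := measure_preserving_iter L_pres n.
have mb n : measurable_fun setT (b n) by exact: integrable_measurable.
have mgood N : measurable (good N).
  apply: measurable_foralln => n; do 2 apply: measurable_set_imply.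
  apply: measurable_existsn => k; apply: measurable_set_and.
  apply: measurable_set_le => //; apply: measurable_funD => //.
  exact: measurableT_comp.
have h0 N w : 0 <= h N w by rewrite /h /patch; case: ifP.
have hg N w : h N w <= g w by rewrite /h /patch; case: ifP.
have mg := integrable_measurable ig.
have mh N : measurable_fun setT (h N).
  apply/(measurable_restrictT g (measurableC (mgood N))).
  exact: measurable_funTS.
have ih N : int (h N).
  by apply: integrable_dominated ig => // w; rewrite ger0_norm.
have hlim : (fun N => E (h N)) @ \oo --> 0.
  have [//|||||_ _] := @dominated_convergence _ T R mu setT measurableT
      (fun N => EFin \o h N) (EFin \o cst 0) (EFin \o g).
  - by move=> N; exact/measurable_EFinP.
  - exact/measurable_EFinP.
  - apply: filterS aeg => w [N0 gN0] _; apply: cvg_near_cst.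
    exists N0 => // N /= N0N; rewrite /h patchE memNset//= => -[]/= n Nn n0.
    by apply: gN0 => //; exact: leq_trans Nn.
  - by [].
  - by apply/aeW => w n _ /=; rewrite lee_fin ger0_norm.
  - rewrite integral0 => /fine_cvg; exact.
have Eg0 : 0 <= E g by exact: Rintegral_ge0.
have key N n : n%:R * alpha <= n%:R * (c + E (h N)) + N%:R * E g.
  pose F p w := c + h N (iter p L w) +
    (if (n <= p + N)%N then g (iter p L w) else 0).
  have ilast p : int (fun w => if (n <= p + N)%N then g (iter p L w) else 0).
    by case: leqP => _; [exact: (integrable_iter p ig)|exact: integrable_const].
  have ich p : int (fun w => c + h N (iter p L w)).
    exact: (integrable_addR (integrable_const mu c)
              (integrable_iter p (ih N))).
  have iF p : int (F p).
    exact: (integrable_addR (ich p) (ilast p)).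
  have EF p : E (F p) = c + E (h N) + (if (n <= p + N)%N then E g else 0).
    rewrite (RintegralD measurableT (ich p) (ilast p)).
    rewrite (RintegralD measurableT (integrable_const mu c)
      (integrable_iter p (ih N))).
    rewrite Rintegral_const (Rintegral_iter p (ih N)); congr (_ + _).
    by case: leqP => _; [exact: (Rintegral_iter p ig)|exact: Rintegral_const].
  apply: le_trans (balpha n) _.
  apply: (@le_trans _ _ (E (fun w => \sum_(0 <= p < n) F p w))).
    apply: le_Rintegral => //; first exact: integrable_sumR.
    move=> w _; apply: jump_cover => // {}w.
    have [gw|gw] := pselect (good N w); [by left|right].
    by rewrite /h patchE mem_set.
  rewrite Rintegral_sum//; under eq_bigr do rewrite EF.
  rewrite big_split /= sumr_const_nat subn0 -[X in X + _]mulr_natl lerD2l.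
  exact: sum_last_le.
have key2 N : alpha <= c + E (h N).
  exact: (@le_of_nat_multiples _ _ _ (N%:R * E g)).
have hc : (fun N => c + E (h N)) @ \oo --> c + 0.
  by apply: cvgD => //; exact: cvg_cst.
by rewrite -[c]addr0; apply: (cvgr_to_ge hc); exact: nearW.
Qed.

End covering.

(** * Almost sure linear bounds for the displacement *)

Section metric_cocycle.
Context (R : realType) (d : measure_display) (T : measurableType d).
Context (mu : probability T R).
Context (L : T -> T) (L_pres : measure_preserving mu L) (L_erg : ergodic mu L).
Context (a : nat -> T -> R).
Hypothesis a0 : forall w, a 0%N w = 0.
Hypothesis a_ge0 : forall n w, 0 <= a n w.
(** With [a_tail] and [a_head], these are the three triangle inequalities between x0, Z_n x0 and
    Z_(n+m) x0. *)
Hypothesis a_sub : forall n m w, a (n + m)%N w <= a n w + a m (iter n L w).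
Hypothesis a_tail : forall n m w, a m (iter n L w) <= a n w + a (n + m)%N w.
Hypothesis a_head : forall n m w, a n w <= a (n + m)%N w + a m (iter n L w).
Hypothesis ma : forall n, measurable_fun setT (a n).

Local Notation int f := (mu.-integrable setT (EFin \o f)).
Local Notation E f := (Rintegral mu setT f).

Hypothesis ia1 : int (a 1%N).

Lemma ergodic_ae (A : set T) : measurable A -> L @^-1` A = A ->
  {ae mu, forall w, A w} \/ {ae mu, forall w, ~ A w}.
Proof.
move=> mA invA; have [muA|muA] := L_erg mA invA; [right|left].
  have : mu.-negligible A by apply/negligibleP.
  by apply: negligibleS => w /= /contrapT.
apply/negligibleP; first exact: measurableC.
by apply: (eq_trans (probability_setC mu mA)); rewrite muA subee.
Qed.

Lemma integrable_cocycle n : int (a n).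
Proof.
elim: n => [|n IH].
  by apply: integrable_dominated (integrable_const mu 0) => // w; rewrite a0 normr0.
apply: integrable_dominated
  (integrable_addR ia1 (integrable_comp_pres L_pres IH)) => // w.
by rewrite ger0_norm//=; exact: a_sub 1%N n w.
Qed.

(* Sum a (l + m) w - a l w <= a m (L^l w) over l < n and telescope. *)
Lemma cocycle_le_birkhoff m n w :
  m%:R * a n w <= \sum_(0 <= l < n) a m (iter l L w)
    + \sum_(0 <= i < m) a i w + \sum_(0 <= i < m) a i (iter n L w).
Proof.
have tele : \sum_(0 <= i < m) a (n + i)%N w <=
    \sum_(0 <= l < n) a m (iter l L w) + \sum_(0 <= i < m) a i w.
  elim: n => [|n IH]; first by rewrite big_nil add0r.
  (* The same sum is split at its last term on the left and at its first term on the right. *)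
  have : \sum_(0 <= i < m.+1) a (n + i)%N w = \sum_(0 <= i < m.+1) a (n + i)%N w.
    by [].
  rewrite {1}big_nat_recr//= big_nat_recl//= addn0 => e.
  rewrite big_nat_recr//=; under eq_bigr do rewrite addSnnS.
  by have := a_sub n m w; lra.
rewrite -lerBlDr; apply: le_trans tele.
rewrite lerBlDr -big_split /= mulr_natl -{1}[m]subn0 -sumr_const_nat.
by apply: ler_sum => i _; exact: a_head.
Qed.

(** The failure set [B] is invariant. If it had full measure, an additive process of mean
    [m * c - E (a m) > 0] per step would admit jumps at rate 0, against [drift_le_jump_rate]. *)
Lemma cocycle_upper m c : (0 < m)%N -> E (a m) < m%:R * c ->
  {ae mu, forall w, exists K : nat, forall n, a n w <= c * n%:R + K%:R}.
Proof.
move=> m0 Ec.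
pose B := [set w | forall K : nat, exists n, c * n%:R + K%:R < a n w].
have mB : measurable B.
  apply: measurable_foralln => K; apply: measurable_existsn => n.
  exact: measurable_set_lt.
have invB : L @^-1` B = B.
  (* Passing between [w] and [L w] changes the displacement by at most [a 1 w] and the linear term
     by [c]; a larger constant [J] absorbs both. *)
  apply/seteqP; split=> w /= Bw K.
    have [J Jle] := natr_bound (K%:R + a 1%N w + c).
    have [n nJ] := Bw J; exists n.+1; rewrite -natr1.
    by have := a_tail 1%N n w; rewrite add1n /=; lra.
  have [J Jle] := natr_bound (K%:R + a 1%N w - c).
  have [[|n] nJ] := Bw J.
    by move: nJ; rewrite a0 mulr0 add0r ltrn0.
  exists n; move: nJ; rewrite -natr1.
  by have := a_sub 1%N n w; rewrite add1n /=; lra.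
have [aeB|] := ergodic_ae mB invB; last first.
  apply: filterS => w /existsNP[K /forallNP nB]; exists K => n.
  by rewrite leNgt; apply/negP.
suff : m%:R * c - E (a m) <= 0 by lra.
pose u w := \sum_(0 <= i < m) a i w.
have iu : int u by apply: integrable_sumR; exact: integrable_cocycle.
(* b n is the n-th Birkhoff sum of m c - a m - u \o L + u; the coboundary absorbs
   the boundary terms of cocycle_le_birkhoff, so that b n <= m (c n - a n) + 2 u
   is negative infinitely often on B. *)
pose b n w := m%:R * c * n%:R - \sum_(0 <= l < n) a m (iter l L w)
  - u (iter n L w) + u w.
have bD n k w : b (n + k)%N w = b n w + b k (iter n L w).
  rewrite /b (big_cat_nat (leq0n n) (leq_addr k n))/=.
  have -> : \sum_(n <= l < n + k) a m (iter l L w) =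
      \sum_(0 <= l < k) a m (iter l L (iter n L w)).
    rewrite -{1}[n]add0n big_addn addKn.
    by apply: eq_bigr => l _; rewrite iterD.
  rewrite -iterD [(k + n)%N]addnC natrD; ring.
have isum n : int (fun w => \sum_(0 <= l < n) a m (iter l L w)).
  by apply: integrable_sumR => l; exact: (integrable_iter L_pres l (integrable_cocycle m)).
have iuL n := integrable_iter L_pres n iu.
have ib n : int (b n).
  apply: (integrable_addR _ iu).
  apply: (integrable_subR _ (iuL n)).
  exact: (integrable_subR (integrable_const _ _) (isum n)).
have ig : int (fun w => `|b 1%N w|).
  exact: (integrable_norm (ib 1%N)).
apply: (@drift_le_jump_rate _ _ _ mu _ L_pres b (fun w => `|b 1%N w|)) => //.
- by move=> w; rewrite /b big_nil /=; lra.
- by move=> n w; rewrite -add1n bD /= lerD2r ler_norm.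
- apply: filterS aeB => w Bw.
  (* This [K] makes [b k w <= 0]; since [b] is additive, the same [k] is a jump at rate 0 for every
     [n >= k]. *)
  have [K Kle] := natr_bound (2 * u w).
  have [k kK] := Bw K.
  have k0 : (0 < k)%N.
    by case: k kK => //; rewrite a0 mulr0 add0r ltrn0.
  exists k => n kn n0; exists k; split; first by rewrite k0.
  rewrite mul0r add0r -{1}(subnKC kn) bD gerDr /b.
  have := cocycle_le_birkhoff m k w; rewrite -/(u w) -/(u (iter k L w)).
  have : 1 <= m%:R :> R by rewrite ler1n.
  have : 0 <= K%:R :> R by [].
  by set M := m%:R; nra.
(* By invariance the integrals of [u] and [u \o iter n L] cancel, leaving
   [n * (m * c - E (a m))]. *)
- move=> n.
  rewrite (RintegralD measurableT (integrable_subR (integrable_subR (integrable_const mu _) (isum n)) (iuL n)) iu).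
  rewrite (RintegralB measurableT (integrable_subR (integrable_const mu _) (isum n)) (iuL n)).
  rewrite (RintegralB measurableT (integrable_const mu _) (isum n)).
  rewrite Rintegral_const (Rintegral_iter L_pres n iu) Rintegral_sum; last first.
    by move=> l; exact: (integrable_iter L_pres l (integrable_cocycle m)).
  under eq_bigr do rewrite (Rintegral_iter L_pres _ (integrable_cocycle m)).
  by rewrite sumr_const_nat subn0 -mulr_natl; lra.
Qed.

(** If the invariant set [F] were null, then already for [K = 0] every large [n] would have some
    violating [k], that is a jump of [a] at rate [c], forcing [alpha <= c]. *)
Lemma cocycle_lower c alpha : 0 <= c -> c < alpha ->
  (forall n, n%:R * alpha <= E (a n)) ->
  {ae mu, forall w, exists K : nat, forall N, exists n, (N <= n)%N /\
     forall k, (k <= n)%N ->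
       c * k%:R - K%:R <= a n w - a (n - k)%N (iter k L w)}.
Proof.
move=> c0 ca Ea.
pose F := [set w | exists K : nat, forall N, exists n, (N <= n)%N /\
  forall k, (k <= n)%N ->
    c * k%:R - K%:R <= a n w - a (n - k)%N (iter k L w)].
have mF : measurable F.
  apply: measurable_existsn => K; apply: measurable_foralln => N.
  apply: measurable_existsn => n; apply: measurable_set_and.
  apply: measurable_foralln => k; apply: measurable_set_imply.
  apply: measurable_set_le => //; apply: measurable_funB => //.
  apply: measurableT_comp => //.
  by have [] := measure_preserving_iter L_pres k.
have invF : L @^-1` F = F.
  (* Both [n] and [k] shift by one, which keeps [n - k]; in the first inclusion [k = 0] is trivial,
     and in the second [N.+1] ensures that [n] is a successor. *)
  apply/seteqP; split=> w /= -[K FK].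
    have [J Jle] := natr_bound (K%:R + a 1%N w + c).
    exists J => N; have [n [Nn Fn]] := FK N.
    exists n.+1; split=> [|[|k] kn]; first exact: leqW.
      by have := a_ge0 1%N w; have : 0 <= K%:R :> R by []; rewrite subn0 /=; lra.
    have := Fn k kn; rewrite subSS -iterSr -natr1.
    by have := a_tail 1%N n w; rewrite add1n /=; lra.
  have [J Jle] := natr_bound (K%:R + a 1%N w).
  exists J => N; have [[|n] [Nn Fn]] := FK N.+1; first by [].
  exists n; split=> // k kn.
  have := Fn k.+1 kn; rewrite subSS iterSr -natr1.
  by have := a_sub 1%N n w; rewrite add1n /=; lra.
have [//|aeF] := ergodic_ae mF invF.
exfalso; suff : alpha <= c by lra.
apply: (@drift_le_jump_rate _ _ _ mu _ L_pres a (a 1%N)) => //.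
- exact: integrable_cocycle.
- by move=> w; rewrite a0.
- by move=> n w; exact: a_sub 1%N n w.
apply: filterS aeF => w /forallNP/(_ 0%N)/existsNP[N /forallNP nF].
exists N => n Nn n0; have /not_andP[//|/existsNP[k]] := nF n.
move=> /not_implyP[kn /negP]; rewrite -ltNge subr0 => ak.
exists k; split; last by lra.
(* A violating [k] is positive, since at [k = 0] both sides vanish. *)
by rewrite kn andbT lt0n; apply/eqP => k0; move: ak; rewrite k0 subn0 /=; lra.
Qed.

End metric_cocycle.

(** * The group cocycle and the common point of the shadows *)

Lemma cocycleD (G : groupType) (T : Type) (L : T -> T) (g1 : T -> G) n m w :
  cocycle L g1 (n + m)%N w = (cocycle L g1 n w * cocycle L g1 m (iter n L w))%g.
Proof.
rewrite /cocycle big_split_ord /=; congr (_ * _)%g.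
by apply: eq_bigr => i _; rewrite addnC iterD.
Qed.

Lemma mdist_cocycle (R : realType) (X : metricType R) (x0 : X)
    (G : groupType) (act : G -> X -> X) (act_isom : isometric_action act)
    (T : Type) (L : T -> T) (g1 : T -> G) n m w :
  mdist (act (cocycle L g1 (n + m)%N w) x0) (act (cocycle L g1 n w) x0) =
  mdist (act (cocycle L g1 m (iter n L w)) x0) x0.
Proof. by have [_ actM actd] := act_isom; rewrite cocycleD actM actd. Qed.

(** Here (1 - e)(1 + delta) = (1 - delta) - (e - 2 delta) - e delta, so for large [k] the surplus
    [k * (A * (e - 2 * delta))] absorbs the additive constants. It is applied with [r = a k w] and
    [s = a n w - a (n - k) (iter k L w)]. *)
Lemma displacement_gap (R : realType) (A e delta K1 K2 k r s : R) :
  0 < A -> e <= 1 -> 0 <= delta -> 0 <= K1 -> 0 <= k ->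
  K1 + K2 <= k * (A * (e - 2 * delta)) -> 0 <= e -> 
  r <= A * (1 + delta) * k + K1 -> A * (1 - delta) * k - K2 <= s ->
  (1 - e) * r <= s.
Proof.
move=> A0 e1 d0 K10 k0 Kk e0 rk sk.
have h1 : (1 - e) * r <= (1 - e) * (A * (1 + delta) * k + K1).
  by rewrite ler_wpM2l// subr_ge0.
apply: le_trans h1 _; apply: le_trans sk.
have : 0 <= A * k * (e * delta) by rewrite !mulr_ge0// ltW.
have : 0 <= e * K1 by rewrite mulr_ge0.
by nra.
Qed.

Theorem theorem1p2 (R : realType)
    (X : metricType R) (x0 : X)
    (G : groupType) (act : G -> X -> X) (act_isom : isometric_action act)
    (d : measure_display) (Omega : measurableType d)
    (Omega_std : standard_borel R Omega)
    (mu : probability Omega R)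
    (L : Omega -> Omega)
    (L_pres : measure_preserving mu L) (L_erg : ergodic mu L)
    (g1 : Omega -> G)
    (g1_meas : forall n : nat, (0 < n)%N ->
       measurable_fun setT
         (fun w : Omega => mdist (act (cocycle L g1 n w) x0) x0))
    (g1_int : (\int[mu]_w (mdist (act (g1 w) x0) x0)%:E < +oo)%E)
    (ballistic : (0 < drift mu L act x0 g1)%E) :
  {ae mu, forall w : Omega, forall eps : R, 0 < eps ->
    exists N : nat, forall M : nat, (N < M)%N ->
      \bigcap_(k in [set k : nat | (N <= k <= M)%N])
        shadow x0 eps (act (cocycle L g1 k w) x0) !=set0}.
Proof.
have [act1 _ _] := act_isom.
pose a n w := mdist (act (cocycle L g1 n w) x0) x0.
have a0 w : a 0%N w = 0 by rewrite /a /cocycle big_ord0 act1 mdistxx.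
have a_ge0 n w : 0 <= a n w by exact: mdist_ge0.
have a_sub n m w : a (n + m)%N w <= a n w + a m (iter n L w).
  rewrite /a -mdist_cocycle// addrC; exact: metric_triangle.
have a_tail n m w : a m (iter n L w) <= a n w + a (n + m)%N w.
  rewrite /a -mdist_cocycle// addrC [X in _ + X]metric_sym.
  exact: metric_triangle.
have a_head n m w : a n w <= a (n + m)%N w + a m (iter n L w).
  rewrite /a -mdist_cocycle// addrC [X in _ <= X + _]metric_sym.
  exact: metric_triangle.
have ma n : measurable_fun setT (a n).
  case: n => [|n]; last exact: g1_meas.
  by rewrite (_ : a 0%N = cst 0)//; apply/funext.
have ia1 : mu.-integrable setT (EFin \o a 1%N).
  apply/integrableP; split; first exact/measurable_EFinP.
  apply: le_lt_trans g1_int; rewrite le_eqVlt; apply/orP; left; apply/eqP.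
  apply: eq_integral => w _ /=; rewrite ger0_norm//.
  by rewrite /a /cocycle big_ord_recl big_ord0 mulg1.
have ia n := integrable_cocycle L_pres a0 a_ge0 a_sub ma ia1 n.
have intE n : (\int[mu]_w (a n w)%:E = (Rintegral mu setT (a n))%:E)%E.
  by rewrite fineK//; apply: integrable_fin_num => //; exact: ia.
have driftE : drift mu L act x0 g1 = ereal_inf
    [set ((n%:R^-1 * Rintegral mu setT (a n))%:E)%E | n in [set n | (0 < n)%N]].
  rewrite /drift; congr ereal_inf; apply: eq_imagel => n _.
  by rewrite -/(a n) intE EFinM.
have dfin : drift mu L act x0 g1 \is a fin_num.
  rewrite ge0_fin_numE; last exact: ltW.
  rewrite driftE; apply: (@le_lt_trans _ _ (1%:R^-1 * Rintegral mu setT (a 1%N))%:E).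
    by apply: ereal_inf_lbound; exists 1%N.
  exact: ltry.
pose A := fine (drift mu L act x0 g1).
have AE : A%:E = drift mu L act x0 g1 by rewrite fineK.
have A0 : 0 < A by rewrite -lte_fin AE.
have Alow n : n%:R * A <= Rintegral mu setT (a n).
  case: n => [|n]; first by rewrite mul0r; apply: Rintegral_ge0 => w _; exact: a_ge0.
  rewrite -ler_pdivlMl ?ltr0n// -lee_fin AE driftE.
  by apply: ereal_inf_lbound; exists n.+1.
have Aup c : A < c -> exists2 m, (0 < m)%N & Rintegral mu setT (a m) < m%:R * c.
  rewrite -lte_fin AE driftE => /ereal_inf_lt[_ [m /= m0 <-]].
  by rewrite lte_fin ltr_pdivrMl ?ltr0n// => mc; exists m.
(* Countably many values, so that one null set serves every [eps]; starting at 1/2 keeps the rate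
   [A * (1 - delta j)] nonnegative for [cocycle_lower]. *)
pose delta j : R := j.+2%:R^-1.
have delta0 j : 0 < delta j by rewrite invr_gt0.
have delta1 j : delta j < 1 by rewrite invf_lt1// ltr1n.
have upper j : {ae mu, forall w, exists K : nat, forall n,
    a n w <= A * (1 + delta j) * n%:R + K%:R}.
  have [|m m0 Em] := Aup (A * (1 + delta j)); first by have := delta0 j; nra.
  exact: (cocycle_upper L_pres L_erg a0 a_ge0 a_sub a_tail a_head ma ia1 m0 Em).
have lower j : {ae mu, forall w, exists K : nat, forall N, exists n,
    (N <= n)%N /\ forall k, (k <= n)%N ->
    A * (1 - delta j) * k%:R - K%:R <= a n w - a (n - k)%N (iter k L w)}.
  apply: (cocycle_lower L_pres L_erg a0 a_ge0 a_sub a_tail ma ia1 _ _ Alow).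
    by have := delta1 j; nra.
  by have := delta0 j; nra.
apply: filterS2 (ae_foralln upper) (ae_foralln lower) => w up low eps eps0.
(* Truncation at 1 keeps [1 - e] nonnegative, so that an upper bound on [a k w] may be multiplied by
   it. *)
pose e := Num.min eps 1.
have e0 : 0 < e by rewrite lt_min eps0 ltr01.
have e1 : e <= 1 by rewrite ge_min lexx orbT.
have eeps : e <= eps by rewrite ge_min lexx.
have [j jle] := natr_bound (2 / e).
have dj : 2 * delta j < e.
  move: jle; rewrite ler_pdivrMr// ltr_pdivrMr// -addn2 natrD; nra.
have [K1 up1] := up j; have [K2 low2] := low j.
have [N Nle] := natr_bound ((K1%:R + K2%:R) / (A * (e - 2 * delta j))).
(* [N] is fixed before [M]; only the endpoint [n >= M] depends on [M], and [Fn] covers all [k <= n]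
   at once. *)
exists N => M NM; have [n [Mn Fn]] := low2 M.
exists (act (cocycle L g1 n w) x0) => k /andP[Nk kM].
have kn : (k <= n)%N by exact: leq_trans Mn.
(* The shadow condition becomes [a k w + a (n - k) (iter k L w) <= a n w + eps * a k w]. *)
rewrite /shadow /= ![mdist x0 _]metric_sym -{1}(subnKC kn).
rewrite [mdist (act (cocycle L g1 k w) x0) _]metric_sym mdist_cocycle//.
rewrite -/(a k w) -/(a n w) -/(a (n - k)%N (iter k L w)).
have gap : (1 - e) * a k w <= a n w - a (n - k)%N (iter k L w).
  apply: (@displacement_gap _ A e (delta j) K1%:R K2%:R k%:R) => //.
  - exact: ltW.
  - rewrite -ler_pdivrMr; last by rewrite mulr_gt0// subr_gt0.
    by apply: le_trans Nle _; rewrite ler_nat.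
  - exact: ltW.
  - exact: Fn.
have : e * a k w <= eps * a k w by rewrite ler_wpM2r.
by lra.
Qed.
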